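(* Let $f\in C(\Omega)\cap L^\infty(\Omega)$ and $g\in C(\partial\Omega)$. There exists a viscosity solution $u\in C(\bar\Omega)$ of $$-\Delta_\infty u=f\ \text{ in }\Omega,\qquad u=g\ \text{ on }\partial\Omega.$$
   Context: $\Omega\subseteq\mathbb{R}^n$ is a bounded, connected, open set. It is assumed that $\operatorname{diam}(\Omega):=\sup\{d(x,y):x,y\in\bar\Omega\}<\infty$, where $d(x,y)$ is the infimum of the lengths of Lipschitz paths in $\bar\Omega$ joining $x$ to $y$. For a $C^2$ function $\varphi$ near $x$: if $D\varphi(x)\ne0$, $\Delta_\infty^+\varphi(x)=\Delta_\infty^-\varphi(x):=|D\varphi(x)|^{-2}\langle D^2\varphi(x)D\varphi(x),D\varphi(x)\rangle$; if $D\varphi(x)=0$, $\Delta_\infty^+\varphi(x):=\max_{|v|=1}\langle D^2\varphi(x)v,v\rangle$ and $\Delta_\infty^-\varphi(x):=\min_{|v|=1}\langle D^2\varphi(x)v,v\rangle$. An upper semicontinuous $u$ is a viscosity subsolution of $-\Delta_\infty u=f$ in $\Omega$ if, for every polynomial $\varphi$ of degree 2 (at most) and $x_0\in\Omega$ such that $u-\varphi$ has a strict local maximum at $x_0$, $-\Delta_\infty^+\varphi(x_0)\le f(x_0)$. A lower semicontinuous $u$ is a viscosity supersolution if, for every such $\varphi$ and $x_0\in\Omega$ such that $u-\varphi$ has a strict local minimum at $x_0$, $-\Delta_\infty^-\varphi(x_0)\ge f(x_0)$. A viscosity solution is both. (Equivalently, one may use all $\varphi\in C^2$ and non-strict extrema.)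 *)

(* Defs.v *)
From mathcomp Require Import all_boot all_order all_algebra.
From mathcomp Require Import all_classical all_reals all_analysis.

Set Implicit Arguments.
Unset Strict Implicit.
Unset Printing Implicit Defensive.

Import Order.TTheory GRing.Theory Num.Theory.
Import numFieldNormedType.Exports.

Local Open Scope classical_set_scope.
Local Open Scope ring_scope.

(* R^n is 'rV[R]_n.  Its library norm is the sup norm; it is used below only
   through notions that do not depend on the choice of a norm on R^n
   (topology, boundedness, being Lipschitz, derivatives).  All metric
   quantities use the Euclidean norm [enorm]. *)

Definition dotp (R : realType) (n : nat) (x y : 'rV[R]_n) : R :=
  \sum_(i < n) x 0 i * y 0 i.

Definition enorm (R : realType) (n : nat) (x : 'rV[R]_n) : R :=
  Num.sqrt (dotp x x).

Definition boundary (T : topologicalType) (A : set T) : set T :=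
  closure A `\` interior A.

(* Supremum of the lengths of inscribed polygonal lines, in the style of
   [variation] and [total_variation] for real-valued functions. *)
Definition path_length (R : realType) (n : nat) (gamma : R -> 'rV[R]_n) :
    \bar R :=
  ereal_sup [set (\sum_(0 <= k < size s)
                    enorm (gamma (nth 1 (0 :: s) k.+1)
                           - gamma (nth 1 (0 :: s) k)))%:E
            | s in [set s : seq R | itv_partition 0 1 s]].

Definition lipschitz_path (R : realType) (n : nat) (A : set 'rV[R]_n)
    (x y : 'rV[R]_n) (gamma : R -> 'rV[R]_n) : Prop :=
  [/\ [lipschitz gamma t | t in `[0, 1]],
      forall t, 0 <= t <= 1 -> A (gamma t),
      gamma 0 = x
    & gamma 1 = y].

(* Equal to +oo when no Lipschitz path in A joins x to y. *)
Definition path_dist (R : realType) (n : nat) (A : set 'rV[R]_n)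
    (x y : 'rV[R]_n) : \bar R :=
  ereal_inf [set path_length gamma | gamma in lipschitz_path A x y].

Definition path_diam (R : realType) (n : nat) (Omega : set 'rV[R]_n) :
    \bar R :=
  ereal_sup [set path_dist (closure Omega) p.1 p.2
            | p in closure Omega `*` closure Omega].

Definition grad (R : realType) (n : nat) (phi : 'rV[R]_n -> R)
    (x : 'rV[R]_n) : 'rV[R]_n :=
  \row_(i < n) 'D_(delta_mx 0 i) phi x.

Definition hessian (R : realType) (n : nat) (phi : 'rV[R]_n -> R)
    (x : 'rV[R]_n) : 'M[R]_n :=
  \matrix_(i < n, j < n)
    'D_(delta_mx 0 i) (fun y => 'D_(delta_mx 0 j) phi y) x.

(* <D^2 phi(x) v, v> *)
Definition hessian_form (R : realType) (n : nat) (phi : 'rV[R]_n -> R)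
    (x v : 'rV[R]_n) : R :=
  (v *m hessian phi x *m v^T) 0 0.

(* For n > 0 the unit sphere is nonempty and compact, so that [sup] and [inf]
   are a maximum and a minimum. *)
Definition inf_laplacian_plus (R : realType) (n : nat)
    (phi : 'rV[R]_n -> R) (x : 'rV[R]_n) : R :=
  if grad phi x == 0 then
    sup [set hessian_form phi x v | v in [set v | enorm v = 1]]
  else enorm (grad phi x) ^- 2 * hessian_form phi x (grad phi x).

Definition inf_laplacian_minus (R : realType) (n : nat)
    (phi : 'rV[R]_n -> R) (x : 'rV[R]_n) : R :=
  if grad phi x == 0 then
    inf [set hessian_form phi x v | v in [set v | enorm v = 1]]
  else enorm (grad phi x) ^- 2 * hessian_form phi x (grad phi x).

Definition polynomial_deg_le2 (R : realType) (n : nat)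
    (phi : 'rV[R]_n -> R) : Prop :=
  exists (c : R) (p : 'rV[R]_n) (A : 'M[R]_n),
    forall y, phi y = c + dotp p y + (y *m A *m y^T) 0 0.

Definition strict_local_max (R : realType) (n : nat) (w : 'rV[R]_n -> R)
    (x : 'rV[R]_n) : Prop :=
  \forall y \near x^', w y < w x.

Definition strict_local_min (R : realType) (n : nat) (w : 'rV[R]_n -> R)
    (x : 'rV[R]_n) : Prop :=
  \forall y \near x^', w x < w y.

Definition lsc_on (R : realType) (n : nat) (A : set 'rV[R]_n)
    (u : 'rV[R]_n -> R) : Prop :=
  lower_semicontinuous (fun x : subspace A => (u x)%:E).

Definition usc_on (R : realType) (n : nat) (A : set 'rV[R]_n)
    (u : 'rV[R]_n -> R) : Prop :=
  lsc_on A (fun x => - u x).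

(* Omega is meant to be open, so that only the values of u on Omega matter in
   the next two definitions, although u is a total function. *)
Definition viscosity_subsolution (R : realType) (n : nat)
    (Omega : set 'rV[R]_n) (f u : 'rV[R]_n -> R) : Prop :=
  usc_on Omega u /\
  forall (phi : 'rV[R]_n -> R) (x0 : 'rV[R]_n),
    polynomial_deg_le2 phi -> Omega x0 ->
    strict_local_max (fun y => u y - phi y) x0 ->
    - inf_laplacian_plus phi x0 <= f x0.

Definition viscosity_supersolution (R : realType) (n : nat)
    (Omega : set 'rV[R]_n) (f u : 'rV[R]_n -> R) : Prop :=
  lsc_on Omega u /\
  forall (phi : 'rV[R]_n -> R) (x0 : 'rV[R]_n),
    polynomial_deg_le2 phi -> Omega x0 ->
    strict_local_min (fun y => u y - phi y) x0 ->
    - inf_laplacian_minus phi x0 >= f x0.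

Definition viscosity_solution (R : realType) (n : nat)
    (Omega : set 'rV[R]_n) (f u : 'rV[R]_n -> R) : Prop :=
  viscosity_subsolution Omega f u /\ viscosity_supersolution Omega f u.

(* Main.v *)
Require Import Defs.
From mathcomp Require Import all_boot all_order all_algebra.
From mathcomp Require Import all_classical all_reals all_analysis.
From mathcomp Require Import ring lra.
Import Order.TTheory GRing.Theory Num.Theory.
Import numFieldNormedType.Exports.
Local Open Scope classical_set_scope.
Local Open Scope ring_scope.
Set Implicit Arguments.
Unset Strict Implicit.
Unset Printing Implicit Defensive.

(** The solution is the Perron function, the supremum of all continuous
    subsolutions that lie below [g] on the boundary.

    Viscosity subsolutions are handled through second order jets. If [(p, A)]
    touches [w] from above at [x], then some unit vector [v] with [p = |p| v]
    must satisfy [2 <A v, v> >= - f x]. This single condition covers zero and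
    nonzero gradients, and it is stable under limits because the unit sphere is
    compact ([jet_open]).

    The only barriers are quadratic cones [a |x - y| - b / 2 |x - y|^2] with
    [b > sup |f|] and [a] large. Their infinity Laplacian is [- b] away from the
    apex, so subsolutions compare with them ([cone_comparison]), while their
    opposites are subsolutions ([cone_subsolution_at]). Cones with apex at a
    boundary point are barriers there: every boundary point is regular, and the
    Perron function is continuous at the boundary with values [g]
    ([perron_boundary_barrier]). Cones with apex inside bound the increments of
    all members of the class by one slope, so the Perron function is locally
    Lipschitz ([perron_locally_lipschitz]). No semicontinuous envelopes are
    therefore involved, and the class can consist of continuous functions.

    It remains to run Perron's method. A supremum of subsolutions is a
    subsolution ([perron_subsolution]). If the supersolution condition failed at
    a point, a small paraboloid bump could be added there without leaving the
    class, against maximality ([perron_supersolution]). *)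

(** * The Euclidean norm and quadratic forms on row vectors *)

Section Euclid.
Variables (R : realType) (n : nat).
Implicit Types (x y z h p q v : 'rV[R]_n) (A : 'M[R]_n).

Lemma dotpC x y : dotp x y = dotp y x.
Proof. by apply: eq_bigr => i _; rewrite mulrC. Qed.

Lemma dotpDl x y z : dotp (x + y) z = dotp x z + dotp y z.
Proof. by rewrite -big_split; apply: eq_bigr => i _; rewrite mxE mulrDl. Qed.

Lemma dotpZl a x y : dotp (a *: x) y = a * dotp x y.
Proof. by rewrite mulr_sumr; apply: eq_bigr => i _; rewrite mxE mulrA. Qed.

Lemma dotpDr x y z : dotp x (y + z) = dotp x y + dotp x z.
Proof. by rewrite dotpC dotpDl !(dotpC x). Qed.

Lemma dotpZr a x y : dotp x (a *: y) = a * dotp x y.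
Proof. by rewrite dotpC dotpZl dotpC. Qed.

Lemma dotpNl x y : dotp (- x) y = - dotp x y.
Proof. by rewrite -scaleN1r dotpZl mulN1r. Qed.

Lemma dotpNr x y : dotp x (- y) = - dotp x y.
Proof. by rewrite dotpC dotpNl dotpC. Qed.

Lemma dotp0l x : dotp 0 x = 0.
Proof. by rewrite -(scale0r x) dotpZl mul0r. Qed.

Lemma dotp0r x : dotp x 0 = 0.
Proof. by rewrite dotpC dotp0l. Qed.

Definition dotpE := (dotpDl, dotpDr, dotpZl, dotpZr, dotpNl, dotpNr).

Lemma dotp_mx x y : dotp x y = (x *m y^T) 0 0.
Proof. by rewrite mxE; apply: eq_bigr => i _; rewrite mxE. Qed.

Lemma dotp_mulmx x y A : dotp (x *m A) y = dotp x (y *m A^T).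
Proof. by rewrite !dotp_mx trmx_mul trmxK mulmxA. Qed.

Lemma dotpp_ge0 x : 0 <= dotp x x.
Proof. by apply: sumr_ge0 => i _; rewrite -expr2 sqr_ge0. Qed.

Lemma enorm_ge0 x : 0 <= enorm x. Proof. exact: sqrtr_ge0. Qed.

Lemma sqr_enorm x : enorm x ^+ 2 = dotp x x.
Proof. by rewrite sqr_sqrtr ?dotpp_ge0. Qed.

Lemma enormZ a x : enorm (a *: x) = `|a| * enorm x.
Proof.
by rewrite /enorm dotpZl dotpZr mulrA -expr2 sqrtrM ?sqr_ge0// sqrtr_sqr.
Qed.

Lemma enormN x : enorm (- x) = enorm x.
Proof. by rewrite -scaleN1r enormZ normrN1 mul1r. Qed.

Lemma enorm0 : enorm (0 : 'rV[R]_n) = 0.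
Proof. by rewrite -(scale0r 0) enormZ normr0 mul0r. Qed.

Lemma enormB x y : enorm (x - y) = enorm (y - x).
Proof. by rewrite -enormN opprB. Qed.

Lemma dotp_le x y : dotp x y <= enorm x * enorm y.
Proof.
have xy0 : 0 <= enorm x * enorm y by rewrite mulr_ge0 ?enorm_ge0.
rewrite (le_trans (ler_norm _))// -ler_sqr ?nnegrE// real_normK ?num_real//.
rewrite exprMn !sqr_enorm.
have := dotpp_ge0 x; rewrite le_eqVlt => /orP[/eqP x0|x_gt0]; last first.
  have := dotpp_ge0 (dotp x x *: y - dotp x y *: x).
  rewrite !dotpE (dotpC y x) => h.
  by rewrite -subr_ge0 -(pmulr_rge0 _ x_gt0); nra.
suff -> : x = 0 by rewrite !dotp0l expr0n mul0r.
apply/rowP => i; rewrite mxE; apply/eqP; rewrite -sqrf_eq0.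
move/esym/eqP: x0; rewrite psumr_eq0 => [/allP/(_ i)|j _]; last first.
  by rewrite -expr2 sqr_ge0.
by rewrite mem_index_enum -expr2 => /(_ isT).
Qed.

Lemma enormD x y : enorm (x + y) <= enorm x + enorm y.
Proof.
rewrite -ler_sqr ?nnegrE ?enorm_ge0 ?addr_ge0 ?enorm_ge0//.
rewrite sqr_enorm !dotpE (dotpC y x) -!sqr_enorm.
by have := dotp_le x y; nra.
Qed.

Lemma ler_dist_enorm x y : `|enorm x - enorm y| <= enorm (x - y).
Proof.
have h1 := enormD (x - y) y; have h2 := enormD (y - x) x.
by rewrite ler_norml enormB; rewrite !subrK enormB in h1 h2 *; lra.
Qed.

Lemma norm_le_enorm x : `|x| <= enorm x.
Proof.
rewrite -[`|x|]/(mx_norm x) mx_normrE; apply: bigmax_le => [|[i j] _] /=.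
  exact: enorm_ge0.
rewrite -ler_sqr ?nnegrE ?enorm_ge0// real_normK ?num_real// sqr_enorm ord1.
rewrite /dotp (bigD1 j)//= -expr2 lerDl sumr_ge0// => k _.
by rewrite -expr2 sqr_ge0.
Qed.

Lemma enorm_le_norm x : enorm x <= n%:R * `|x|.
Proof.
have coord i : `|x 0 i| <= `|x|.
  rewrite -[`|x|]/(mx_norm x) mx_normrE.
  by rewrite (le_bigmax _ (fun ij => `|x ij.1 ij.2|) (0, i)).
rewrite -ler_sqr ?nnegrE ?enorm_ge0 ?mulr_ge0// sqr_enorm.
apply: (@le_trans _ _ (\sum_(i < n) `|x| ^+ 2)).
  apply: ler_sum => i _; rewrite -expr2 -real_normK ?num_real//.
  by rewrite ler_sqr ?nnegrE.
rewrite sumr_const card_ord exprMn -[leLHS]mulr_natl ler_wpM2r ?sqr_ge0//.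
by rewrite -natrX ler_nat -mulnn; case: (n) => // m; rewrite leq_pmull.
Qed.

Lemma enorm_eq0 x : enorm x = 0 -> x = 0.
Proof.
move=> x0; apply/eqP; rewrite -normr_le0.
by rewrite -x0 norm_le_enorm.
Qed.

Lemma enorm_gt0 x : x != 0 -> 0 < enorm x.
Proof.
move=> x0; rewrite lt_neqAle enorm_ge0 andbT eq_sym.
by apply: contra_neq x0 => /enorm_eq0.
Qed.

Lemma nbhs_enormP x (P : set 'rV[R]_n) :
  nbhs x P <-> exists2 r : R, 0 < r & forall y, enorm (y - x) < r -> P y.
Proof.
split=> [/nbhs_ballP[r /= r0 rP]|[r r0 rP]].
  exists r => // y yx; apply: rP; rewrite -ball_normE /=.
  by rewrite distrC (le_lt_trans (norm_le_enorm _)).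
apply/nbhs_ballP; exists (r / n.+1%:R) => /= [|y]; first by rewrite divr_gt0.
rewrite -ball_normE /= distrC ltr_pdivlMr// => yx; apply: rP.
rewrite (le_lt_trans (enorm_le_norm _))// mulrC.
by rewrite (le_lt_trans _ yx)// ler_wpM2l// ler_nat.
Qed.

Lemma mulmx_enorm_le A : exists2 C : R, 0 <= C &
  forall h, enorm (h *m A) <= C * enorm h.
Proof.
exists (Num.sqrt (\sum_j dotp (row j A^T) (row j A^T))); first exact: sqrtr_ge0.
move=> h; rewrite -ler_sqr ?nnegrE ?enorm_ge0 ?mulr_ge0 ?sqrtr_ge0 ?enorm_ge0//.
rewrite exprMn sqr_enorm sqr_sqrtr; last by apply: sumr_ge0 => j _; exact: dotpp_ge0.
rewrite mulr_suml; apply: ler_sum => j _.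
have -> : (h *m A) 0 j = dotp h (row j A^T).
  by rewrite mxE; apply: eq_bigr => k _; rewrite !mxE.
rewrite -expr2 -sqr_enorm -exprMn -[leLHS]real_normK ?num_real// ler_sqr ?nnegrE//.
  rewrite ler_norml mulrC dotp_le andbT.
  by rewrite lerNl -dotpNr -(enormN (row j _)) dotp_le.
by rewrite mulr_ge0 ?enorm_ge0.
Qed.

Definition qf A h := dotp (h *m A) h.

Lemma qfE A h : (h *m A *m h^T) 0 0 = qf A h.
Proof. by rewrite /qf dotp_mx. Qed.

Lemma qfD A x h : qf A (x + h) = qf A x + dotp (x *m (A + A^T)) h + qf A h.
Proof.
rewrite /qf mulmxDl !dotpE mulmxDr dotpDl (dotp_mulmx h) (dotpC h).
lra.
Qed.

Lemma qfZ A a h : qf A (a *: h) = a ^+ 2 * qf A h.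
Proof. by rewrite /qf -scalemxAl !dotpE mulrA. Qed.

Lemma qf0 A : qf A 0 = 0.
Proof. by rewrite /qf mul0mx dotp0l. Qed.

Lemma qfN A h : qf A (- h) = qf A h.
Proof. by rewrite -scaleN1r qfZ sqrrN expr1n mul1r. Qed.

Lemma qfNm A h : qf (- A) h = - qf A h.
Proof. by rewrite /qf mulmxN dotpNl. Qed.

Lemma qfDm A B h : qf (A + B) h = qf A h + qf B h.
Proof. by rewrite /qf mulmxDr dotpDl. Qed.

Lemma qf_scalar a h : qf a%:M h = a * dotp h h.
Proof. by rewrite /qf mul_mx_scalar dotpZl. Qed.

Lemma qf_tr A h : qf A^T h = qf A h.
Proof. by rewrite /qf dotp_mulmx trmxK dotpC. Qed.

End Euclid.

(** * Continuity and compactness in the Euclidean norm *)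

Section Continuity.
Variables (R : realType) (n : nat).
Implicit Types (x y z h p q v : 'rV[R]_n) (A : 'M[R]_n) (K : set 'rV[R]_n).
Implicit Types (w : 'rV[R]_n -> R).

(** Continuity within [K], spelled out with Euclidean balls: touching and
    comparison arguments manipulate explicit Euclidean radii. *)
Definition econtinuous_on K w := forall x, K x -> forall e : R, 0 < e ->
  exists2 r : R, 0 < r & forall y, K y -> enorm (y - x) < r -> `|w y - w x| < e.

Lemma econtinuous_onP K w : {within K, continuous w} <-> econtinuous_on K w.
Proof.
rewrite subspace_continuousP; split=> wc x Kx.
  move=> e e0; have /cvgrPdist_lt/(_ _ e0)/nbhs_enormP[r r0 rw] := wc _ Kx.
  by exists r => // y Ky yx; rewrite distrC; exact: rw.
apply/cvgrPdist_lt => e e0; apply/nbhs_enormP.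
have [r r0 rw] := wc x Kx e e0.
by exists r => // y yx Ky; rewrite distrC; exact: rw.
Qed.

Lemma econtinuousD K w1 w2 : econtinuous_on K w1 -> econtinuous_on K w2 ->
  econtinuous_on K (fun x => w1 x + w2 x).
Proof.
move=> c1 c2 x Kx e e0; have e2 : 0 < e / 2 by rewrite divr_gt0.
have [r1 r10 h1] := c1 x Kx _ e2; have [r2 r20 h2] := c2 x Kx _ e2.
exists (Num.min r1 r2); rewrite ?lt_min ?r10// => y Ky.
rewrite lt_min => /andP[/(h1 _ Ky) + /(h2 _ Ky)].
by rewrite !ltr_norml; lra.
Qed.

Lemma econtinuousN K w : econtinuous_on K w -> econtinuous_on K (fun x => - w x).
Proof.
move=> c x Kx e e0; have [r r0 h] := c x Kx e e0.
by exists r => // y Ky yx; rewrite -opprD normrN h.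
Qed.

Lemma econtinuousB K w1 w2 : econtinuous_on K w1 -> econtinuous_on K w2 ->
  econtinuous_on K (fun x => w1 x - w2 x).
Proof. by move=> c1 c2; apply: econtinuousD => //; exact: econtinuousN. Qed.

Lemma econtinuous_max K w1 w2 : econtinuous_on K w1 -> econtinuous_on K w2 ->
  econtinuous_on K (fun x => Num.max (w1 x) (w2 x)).
Proof.
move=> c1 c2 x Kx e e0.
have [r1 r10 h1] := c1 x Kx _ e0; have [r2 r20 h2] := c2 x Kx _ e0.
exists (Num.min r1 r2); rewrite ?lt_min ?r10// => y Ky.
rewrite lt_min => /andP[/(h1 _ Ky) + /(h2 _ Ky)].
by rewrite !ltr_norml; case: (leP (w1 y)); case: (leP (w1 x)); lra.
Qed.

Lemma econtinuousM K w1 w2 : econtinuous_on K w1 -> econtinuous_on K w2 ->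
  econtinuous_on K (fun x => w1 x * w2 x).
Proof.
move=> /econtinuous_onP c1 /econtinuous_onP c2; apply/econtinuous_onP => x.
by apply: continuousM; [exact: c1|exact: c2].
Qed.

Lemma econtinuous_translate K w x0 : econtinuous_on [set: 'rV[R]_n] w ->
  econtinuous_on K (fun y => w (y - x0)).
Proof.
move=> wc x _ e e0; have [r r0 hr] := wc (x - x0) I e e0.
by exists r => // y _ yx; apply: hr; rewrite // opprB addrA subrK.
Qed.

Lemma econtinuous_cst K (a : R) : econtinuous_on K (fun=> a).
Proof.
by move=> x _ e e0; exists 1 => // y _ _; rewrite subrr normr0.
Qed.

Lemma econtinuous_lipschitz K w (C : R) : 0 <= C ->
  (forall x y, K x -> K y -> w y - w x <= C * enorm (y - x)) ->
  econtinuous_on K w.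
Proof.
move=> C0 wC x Kx e e0; have C1 : 0 < C + 1 by lra.
exists (e / (C + 1)); rewrite ?divr_gt0// => y Ky; rewrite ltr_pdivlMr// => yx.
have := wC _ _ Kx Ky; have := wC _ _ Ky Kx; rewrite enormB.
by have := enorm_ge0 (y - x); rewrite ltr_norml; nra.
Qed.

Lemma econtinuous_enorm K y : econtinuous_on K (fun x => enorm (x - y)).
Proof.
apply: (econtinuous_lipschitz (@ler01 R)) => x z _ _; rewrite mul1r.
rewrite (le_trans (ler_norm _))// (le_trans (ler_dist_enorm _ _))//.
by rewrite opprB addrA subrK.
Qed.

Lemma econtinuous_dotp K p : econtinuous_on K (dotp p).
Proof.
apply: (econtinuous_lipschitz (enorm_ge0 p)) => x y _ _.
by rewrite -dotpNr -dotpDr dotp_le.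
Qed.

Lemma econtinuous_qf K A : econtinuous_on K (qf A).
Proof.
move=> x Kx e e0.
have [C1 C10 h1] := mulmx_enorm_le (A + A^T).
have [C2 C20 h2] := mulmx_enorm_le A.
pose C := C1 * enorm x + C2.
have C0 : 0 < C + 1 by have := enorm_ge0 x; rewrite /C; nra.
exists (Num.min 1 (e / (C + 1))); rewrite ?lt_min ?ltr01 ?divr_gt0// => y Ky.
rewrite lt_min ltr_pdivlMr// => /andP[y1 y2].
set h := y - x in y1 y2; have -> : y = x + h by rewrite addrC subrK.
rewrite qfD (_ : _ - _ = dotp (x *m (A + A^T)) h + qf A h); last lra.
have {}h1 := h1 x; have {}h2 := h2 h; have h0 := enorm_ge0 h.
have a1 := dotp_le (x *m (A + A^T)) h.
have a2 := dotp_le (x *m (A + A^T)) (- h).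
have a3 := dotp_le (h *m A) h.
have a4 := dotp_le (h *m A) (- h).
rewrite !dotpNr !enormN in a2 a4.
have b1 : enorm (x *m (A + A^T)) * enorm h <= C1 * enorm x * enorm h.
  by rewrite ler_wpM2r.
have b2 : enorm (h *m A) * enorm h <= C2 * enorm h.
  by have := enorm_ge0 (h *m A); nra.
have b3 : C * enorm h < e by nra.
by rewrite /qf ltr_norml; rewrite /C in b3; lra.
Qed.

Lemma compact_max K w : K !=set0 -> compact K -> econtinuous_on K w ->
  exists2 c, K c & forall x, K x -> w x <= w c.
Proof.
move=> K0 Kc /econtinuous_onP wc; have [c /set_mem Kc' cP] := EVT_max_rV K0 Kc wc.
by exists c => // x Kx; apply: cP; apply/mem_set.
Qed.

Lemma eclosedP K : (forall x, ~ K x ->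
    exists2 r : R, 0 < r & forall y, enorm (y - x) < r -> ~ K y) -> closed K.
Proof.
move=> h; rewrite -openC openE => x /= /h[r r0 rK].
by apply/nbhs_enormP; exists r.
Qed.

Lemma compact_enorm_le x (r : R) : compact [set y | enorm (y - x) <= r].
Proof.
apply: bounded_closed_compact.
  exists (r + `|x|); split; first by rewrite num_real.
  move=> M rM y /= yr; have := norm_le_enorm (y - x).
  by have := ler_normD (y - x) x; rewrite subrK; lra.
apply: eclosedP => y /negP; rewrite -ltNge => ry.
exists (enorm (y - x) - r) => [|z zy]; first by rewrite subr_gt0.
apply/negP; rewrite -ltNge.
by have := enormD (z - x) (y - z); rewrite addrC addrA subrK (enormB y z); lra.
Qed.

Lemma compact_sphere : compact [set v : 'rV[R]_n | enorm v = 1].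
Proof.
apply: (subclosed_compact _ (compact_enorm_le (x := 0) (r := 1))); last first.
  by move=> v /= v1; rewrite subr0 v1.
apply: eclosedP => v /eqP v1; exists `|enorm v - 1|.
  by rewrite normr_gt0 subr_eq0.
move=> z zv z1; move: zv; rewrite -z1 enormB ltNge => /negP; apply.
exact: ler_dist_enorm.
Qed.

(** Stability of the strict inequality [Delta < 2 c] under perturbation of the
    gradient. The unit vectors compatible with a gradient jump at [p = 0], but
    a vector compatible with some [q] near [p] is almost compatible with [p];
    as the sphere is compact, the larger of [c - qf A v] and the failure of
    compatibility with [p] is bounded below by a positive constant. *)
Lemma jet_open p A (c : R) :
  (forall v, enorm v = 1 -> p = enorm p *: v -> qf A v < c) ->
  exists2 e : R, 0 < e & forall q v, enorm (q - p) < e ->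
    enorm v = 1 -> q = enorm q *: v -> qf A v < c - e.
Proof.
move=> pA; have [S0|] := pselect ([set v : 'rV[R]_n | enorm v = 1] !=set0);
  last first.
  by move=> S0; exists 1 => // q v _ v1; case: S0; exists v.
pose G v := - Num.max (c - qf A v) (enorm (enorm p *: v - p)).
have Gc : econtinuous_on [set v | enorm v = 1] G.
  apply: econtinuousN; apply: econtinuous_max.
    by apply: econtinuousB; [exact: econtinuous_cst|exact: econtinuous_qf].
  apply: (econtinuous_lipschitz (enorm_ge0 p)) => x y _ _.
  rewrite (le_trans (ler_norm _))// (le_trans (ler_dist_enorm _ _))//.
  rewrite opprB addrA subrK -scalerBr enormZ ger0_norm ?enorm_ge0//.
have [v0 v01 Gv0] := compact_max S0 compact_sphere Gc.
have m0 : 0 < - G v0.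
  rewrite /G opprK lt_max subr_gt0.
  have [v0p|v0p] := eqVneq p (enorm p *: v0); first by rewrite pA.
  by rewrite orbC enorm_gt0// subr_eq0 eq_sym.
exists (- G v0 / 2) => [|q v qp v1 qv]; first by rewrite divr_gt0.
have : - G v0 <= Num.max (c - qf A v) (enorm (enorm p *: v - p)).
  by rewrite lerNl; exact: Gv0.
rewrite le_max => /orP[|]; first by lra.
have : enorm (enorm p *: v - p) <= 2 * enorm (q - p).
  (* [v] is compatible with [q], so its defect for [p] is at most twice [|q - p|] *)
  have -> : enorm p *: v - p = (enorm p - enorm q) *: v + (q - p).
    by rewrite scalerBl -qv addrA subrK.
  rewrite (le_trans (enormD _ _))// enormZ v1 mulr1.
  by have := ler_dist_enorm p q; rewrite enormB; lra.
by lra.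
Qed.

End Continuity.

(** * Second order jets and the viscosity conditions *)

Section Jets.
Variables (R : realType) (n : nat).
Implicit Types (x y z h p q v e : 'rV[R]_n) (A B : 'M[R]_n).
Implicit Types (Omega : set 'rV[R]_n) (f w phi : 'rV[R]_n -> R).

Lemma dotp_delta x i : dotp x (delta_mx 0 i) = x 0 i.
Proof.
rewrite /dotp (bigD1 i)//= mxE !eqxx mulr1 big1 ?addr0// => j ji.
by rewrite mxE (negbTE ji) andbF mulr0.
Qed.

Lemma derive_deg2 (c : R) p A phi y v :
  (forall z, phi z = c + dotp p z + qf A z) ->
  'D_v phi y = dotp (p + y *m (A + A^T)) v.
Proof.
move=> phiE; apply: cvg_lim => //; apply/cvgrPdist_lt => e e0; near=> h.
have h0 : h != 0 by near: h; exact: nbhs_dnbhs_neq.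
rewrite /= !phiE [h *: v + y]addrC qfD qfZ !dotpE.
set l := dotp p v; set m := dotp _ v; set k := qf A v.
rewrite /GRing.scale/=.
rewrite (_ : _ - _ = - (h * k)); last by field.
rewrite normrN normrM (@le_lt_trans _ _ (`|h| * (`|k| + 1)))//.
  by rewrite ler_wpM2l// lerDl.
rewrite -ltr_pdivlMr; last by rewrite ltr_wpDl.
by near: h; apply: dnbhs0_lt; rewrite divr_gt0// ltr_wpDl.
Unshelve. all: by end_near. Qed.

(** A quadratic polynomial is its own second order expansion, and the
    derivatives of the statement compute the coefficients. *)
Lemma deg2_expansion phi : polynomial_deg_le2 phi ->
  exists A, forall x,
    (forall h, phi (x + h) = phi x + dotp (grad phi x) h + qf A h) /\
    (forall v, hessian_form phi x v = 2 * qf A v).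
Proof.
move=> [c [p [A phiE0]]]; exists A => x.
have phiE z : phi z = c + dotp p z + qf A z by rewrite phiE0 qfE.
have DE v y : 'D_v phi y = dotp (p + y *m (A + A^T)) v by exact: derive_deg2.
split=> [h|v].
  have -> : grad phi x = p + x *m (A + A^T).
    by apply/rowP => i; rewrite mxE DE dotp_delta.
  by rewrite !phiE qfD !dotpE; lra.
rewrite /hessian_form qfE.
suff -> : hessian phi x = A + A^T by rewrite qfDm qf_tr; lra.
apply/matrixP => i j; rewrite mxE.
rewrite (@derive_deg2 (dotp p (delta_mx 0 j))
           (delta_mx 0 j *m (A + A^T)) 0 (fun y => 'D_(delta_mx 0 j) phi y)).
  rewrite linear0 addr0 mulmx0 addr0 dotp_delta -rowE !mxE; lra.
move=> z; rewrite DE dotpDl dotp_mulmx linearD/= trmxK [A^T + A]addrC.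
by rewrite [dotp z _]dotpC /qf mulmx0 dotp0l addr0.
Qed.

Definition touched_above w x p A := exists2 r : R, 0 < r &
  forall h, enorm h < r -> w (x + h) <= w x + dotp p h + qf A h.

(** Viscosity subsolutions of [- Delta w = f], with non-strict contact. The
    condition that the gradient is a nonnegative multiple of the unit vector
    leaves one direction when [p != 0] and all of them when [p = 0], so that a
    single formula covers both cases of the infinity Laplacian. *)
Definition jet_subsolution Omega f w := forall x p A,
  Omega x -> touched_above w x p A ->
  exists v, [/\ enorm v = 1, p = enorm p *: v & - f x <= 2 * qf A v].

Lemma unit_direction p : (0 < n)%N -> exists v, enorm v = 1 /\ p = enorm p *: v.
Proof.
move=> n0; have [->|p0] := eqVneq p 0.
  exists (delta_mx 0 (Ordinal n0)); split; last by rewrite enorm0 scale0r.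
  by rewrite /enorm dotp_delta mxE !eqxx sqrtr1.
have pgt0 := enorm_gt0 p0; exists ((enorm p)^-1 *: p); split.
  by rewrite enormZ ger0_norm ?invr_ge0 ?enorm_ge0// mulVf// gt_eqF.
by rewrite scalerA mulfV ?scale1r// gt_eqF.
Qed.

Lemma strict_max_touched_above w phi A x :
  (forall h, phi (x + h) = phi x + dotp (grad phi x) h + qf A h) ->
  strict_local_max (fun y => w y - phi y) x ->
  touched_above w x (grad phi x) A.
Proof.
move=> phiE /nbhs_enormP[r r0 rP]; exists r => // h hr.
have [->|h0] := eqVneq h 0.
  by rewrite qf0 dotp0r !addr0.
have := rP (x + h); rewrite [x + h - x]addrC addKr => /(_ hr).
have xh : x + h != x by rewrite -subr_eq0 [x + h - x]addrC addKr.
by move=> /(_ xh); rewrite phiE; lra.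
Qed.

Lemma qf_sphere_bounded A : exists C : R, forall v, enorm v = 1 ->
  `|qf A v| <= C.
Proof.
have [C C0 hC] := mulmx_enorm_le A; exists C => v v1.
have := hC v; rewrite v1 mulr1 => h.
have := dotp_le (v *m A) v; have := dotp_le (v *m A) (- v).
by rewrite dotpNr enormN v1 mulr1 -/(qf A v) ler_norml; lra.
Qed.

Lemma sphere_image_bounded A : exists C : R, forall t : R,
  [set 2 * qf A v | v in [set v | enorm v = 1]] t -> - C <= t <= C.
Proof.
have [C hC] := qf_sphere_bounded A; exists (2 * C) => _ [v /hC + <-].
by rewrite ler_norml; lra.
Qed.

Lemma jet_subsolution_plus Omega f w phi x :
  jet_subsolution Omega f w -> polynomial_deg_le2 phi -> Omega x ->
  strict_local_max (fun y => w y - phi y) x ->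
  - inf_laplacian_plus phi x <= f x.
Proof.
move=> ws /deg2_expansion[A /(_ x)[phiE hessE]] Ox /(strict_max_touched_above phiE).
move=> /(ws _ _ _ Ox)[v [v1 gv fv]]; rewrite lerNl (le_trans fv)//.
rewrite /inf_laplacian_plus; case: ifP => [_|g0].
  rewrite [[set _ | _ in _]](_ : _ = [set 2 * qf A v | v in [set v | enorm v = 1]]).
    have [C hC] := sphere_image_bounded A.
    apply: ub_le_sup; last by exists v.
    by exists C => t /hC /andP[].
  by apply: eq_imagel => z _; rewrite hessE.
rewrite hessE {2}gv qfZ mulrCA mulKf// expf_neq0// gt_eqF//.
by rewrite enorm_gt0// g0.
Qed.

(** A supersolution for [f] is the opposite of a subsolution for [- f], so that
    only subsolutions need a theory. *)
Lemma jet_subsolution_minus Omega f w phi x :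
  jet_subsolution Omega (fun y => - f y) (fun y => - w y) ->
  polynomial_deg_le2 phi -> Omega x ->
  strict_local_min (fun y => w y - phi y) x ->
  - inf_laplacian_minus phi x >= f x.
Proof.
move=> ws /deg2_expansion[A /(_ x)[phiE hessE]] Ox wmin.
have : touched_above (fun y => - w y) x (- grad phi x) (- A).
  case/nbhs_enormP: wmin => r r0 rP; exists r => // h hr.
  rewrite dotpNl qfNm.
  have [->|h0] := eqVneq h 0.
    by rewrite qf0 dotp0r !subr0 addr0.
  have := rP (x + h); rewrite [x + h - x]addrC addKr => /(_ hr).
  have xh : x + h != x by rewrite -subr_eq0 [x + h - x]addrC addKr.
  by move=> /(_ xh); rewrite phiE; lra.
move=> /(ws _ _ _ Ox)[v [v1 gv fv]]; rewrite lerNr.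
rewrite enormN in gv; rewrite qfNm in fv.
apply: (@le_trans _ _ (2 * qf A v)); last by lra.
rewrite /inf_laplacian_minus; case: ifP => [_|g0].
  rewrite [[set _ | _ in _]](_ : _ = [set 2 * qf A v | v in [set v | enorm v = 1]]).
    have [C hC] := sphere_image_bounded A.
    apply: ge_inf; last by exists v.
    by exists (- C) => t /hC /andP[].
  by apply: eq_imagel => z _; rewrite hessE.
rewrite hessE -[X in qf A X]opprK gv qfN qfZ mulrCA mulKf// expf_neq0// gt_eqF//.
by rewrite enorm_gt0// g0.
Qed.

Lemma econtinuous_lsc Omega w : econtinuous_on Omega w -> lsc_on Omega w.
Proof.
move=> /econtinuous_onP wc x a; rewrite lte_fin => ax.
exists [set y | a < w y]; last by move=> y /=; rewrite lte_fin.
exact: (wc x [set z | a < z] (lt_nbhsr ax)).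
Qed.

(** The linear parts dominate at small scale: testing along [t (p - q)]
    forces them to agree, and then rescaling along [v] isolates the quadratic
    parts. *)
Lemma jet_le p A q B (r : R) : 0 < r ->
  (forall h, enorm h < r -> dotp p h + qf A h <= dotp q h + qf B h) ->
  p = q /\ forall v, qf A v <= qf B v.
Proof.
move=> r0 le.
have small v : exists2 s : R, 0 < s & forall t, 0 <= t <= s -> enorm (t *: v) < r.
  have v0 := enorm_ge0 v.
  exists (r / (enorm v + 1)) => [|t /andP[t0]]; first by rewrite divr_gt0//; lra.
  rewrite ler_pdivlMr; last by lra.
  rewrite enormZ ger0_norm//.
  have [->|tn] := eqVneq t 0; first by lra.
  have : 0 < t by rewrite lt_neqAle eq_sym tn.
  by nra.
have pq : p = q.
  apply/eqP; rewrite -subr_eq0; apply/negPn/negP => /enorm_gt0 d0.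
  set d := p - q in d0; have [s s0 hs] := small d.
  set k := qf B d - qf A d; have d20 : 0 < dotp d d by rewrite -sqr_enorm exprn_gt0.
  have key t : 0 < t -> t <= s -> dotp d d <= t * k.
    move=> t0 ts; have /le : enorm (t *: d) < r by rewrite hs ?ts ?ltW.
    rewrite !qfZ !dotpZr => l; rewrite -(ler_pM2l t0) /k.
    by have : dotp d d = dotp p d - dotp q d; [rewrite -dotpNl -dotpDl|nra].
  have k0 : 0 < k by have := key s s0 (lexx _); nra.
  have t0 : 0 < dotp d d / (2 * k) by rewrite divr_gt0// mulr_gt0.
  have [ts|ts] := leP (dotp d d / (2 * k)) s.
    have := key _ t0 ts.
    rewrite (_ : _ / _ * _ = dotp d d / 2); last by field; rewrite gt_eqF.
    by lra.
  have := key s s0 (lexx _); move: ts; rewrite ltr_pdivlMr ?mulr_gt0//; lra.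
split=> // v; have [s s0 hs] := small v.
have /le : enorm (s *: v) < r by apply: hs; rewrite lexx ltW.
by rewrite pq lerD2l !qfZ ler_pM2l ?exprn_gt0.
Qed.

End Jets.

(** * Quadratic cones *)

Section Cones.
Variables (R : realType) (n : nat).
Implicit Types (x y z h p q v e : 'rV[R]_n) (A B : 'M[R]_n).
Implicit Types (Omega : set 'rV[R]_n) (f w : 'rV[R]_n -> R).

(** For [b * |x - y| < a], a radially increasing function whose infinity
    Laplacian is [- b] away from the apex [y]. *)
Definition cone (a b : R) y x := a * enorm (x - y) - b / 2 * enorm (x - y) ^+ 2.

Lemma cone_apex a b y : cone a b y y = 0.
Proof. by rewrite /cone subrr enorm0 expr0n !mulr0 subrr. Qed.

Lemma econtinuous_cone K a b y : econtinuous_on K (cone a b y).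
Proof.
apply: econtinuousB; apply: econtinuousM; rewrite ?expr2;
  try exact: econtinuous_cst; try exact: econtinuous_enorm.
by apply: econtinuousM; exact: econtinuous_enorm.
Qed.

Lemma cone_le a b y x : 0 <= b -> cone a b y x <= a * enorm (x - y).
Proof.
move=> b0; rewrite /cone lerBlDr lerDl mulr_ge0//.
  by rewrite divr_ge0.
by rewrite sqr_ge0.
Qed.

(** On a set of diameter [D], a cone with a fixed curvature [b] can be made
    steep enough to exceed any bound outside a ball around its apex. *)
Lemma cone_large (M d D b : R) : 0 < d -> 0 <= M -> 0 <= b -> 0 <= D ->
  exists2 a, 0 <= a & forall x y, enorm (x - y) <= D ->
  [/\ b * enorm (x - y) < a, 0 <= cone a b y x
    & d <= enorm (x - y) -> M <= cone a b y x].
Proof.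
move=> d0 M0 b0 D0; pose m := M / d.
have m0 : 0 <= m by rewrite divr_ge0// ltW.
have mE : m * d = M by rewrite /m divfK// gt_eqF.
have bD : 0 <= b * D by rewrite mulr_ge0.
exists (m + b * D + 1) => [|x y xyD]; first by lra.
have r0 := enorm_ge0 (x - y); rewrite /cone; set r := enorm (x - y) in xyD r0 *.
have br : b * r <= b * D by rewrite ler_wpM2l.
have brr : b * r * r <= b * D * r by rewrite ler_wpM2r.
have bDr : 0 <= b * D * r by rewrite mulr_ge0.
have mr : 0 <= m * r by rewrite mulr_ge0.
split=> [||dr]; [by lra|by nra|].
by have : m * d <= m * r; [rewrite ler_wpM2l|nra].
Qed.

(** The test functions are polynomials and cones are not, hence this contact
    from above. It has the exact gradient and the exact curvature in the radial
    direction [e], the only data seen by the infinity Laplacian; in orthogonal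
    directions it overestimates, using
    [|r e + h| <= r + t + (|h|^2 - t^2) / r] for small [h] and [t = <e, h>]. The same
    contact serves to compare subsolutions with cones and to show that
    opposite cones are subsolutions. *)
Lemma cone_touched_above (a b : R) y x : x != y -> 0 <= a ->
  let r := enorm (x - y) in let e := r^-1 *: (x - y) in
  exists A, touched_above (cone a b y) x ((a - b * r) *: e) A /\
            qf A e = - b / 2.
Proof.
move=> xy a0 r e; have r0 : 0 < r by rewrite enorm_gt0// subr_eq0.
have e1 : dotp e e = 1.
  by rewrite -sqr_enorm enormZ ger0_norm ?invr_ge0 ?ltW// mulVf ?expr1n ?gt_eqF.
have en1 : enorm e = 1 by rewrite /enorm e1 sqrtr1.
have ze : x - y = r *: e by rewrite scalerA mulfV ?scale1r// gt_eqF.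
clearbody e.
pose A : 'M[R]_n := (a / r - b / 2)%:M - (a / r) *: (e^T *m e).
have AE h : qf A h = (a / r - b / 2) * dotp h h - a / r * dotp e h ^+ 2.
  rewrite qfDm qf_scalar qfNm; congr (_ - _).
  rewrite /qf -scalemxAr dotpZl; congr (_ * _).
  rewrite mulmxA [h *m e^T]mx11_scalar mul_scalar_mx dotpZl -dotp_mx.
  by rewrite (dotpC h) expr2.
exists A; split; last by rewrite AE e1 expr1n; field; rewrite gt_eqF.
exists (r / 2) => [|h hr]; first by rewrite divr_gt0.
rewrite /cone -/r addrAC sqr_enorm ze AE !dotpE e1 (dotpC h e).
set t := dotp e h; set s := dotp h h.
have h0 := enorm_ge0 h.
have sE : s = enorm h ^+ 2 by rewrite sqr_enorm.
have t1 : t <= enorm h by have := dotp_le e h; rewrite en1 mul1r.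
have t2 : - t <= enorm h by have := dotp_le e (- h); rewrite dotpNr enormN en1 mul1r.
have ts : t ^+ 2 <= s by rewrite sE; nra.
pose k := (s - t ^+ 2) / r.
have k0 : 0 <= k by rewrite divr_ge0 ?(ltW r0)// subr_ge0.
have kE : k * r = s - t ^+ 2 by rewrite /k divfK// gt_eqF.
have key : enorm (r *: e + h) <= r + t + k.
  rewrite -ler_sqr ?nnegrE ?enorm_ge0//; last by lra.
  rewrite sqr_enorm !dotpE e1 (dotpC h e) -/t -/s.
  (* [|h| < r / 2] gives [r <= 2 (r + t)] *)
  have : r * k <= 2 * (r + t) * k by rewrite ler_wpM2r//; lra.
  by nra.
have {}key : a * enorm (r *: e + h) <= a * (r + t + k) by rewrite ler_wpM2l.
rewrite (_ : _ + (_ - _) = a * (r + t + k) - b / 2 * (r ^+ 2 + 2 * r * t + s)).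
  by lra.
by rewrite /k; field; rewrite gt_eqF.
Qed.

Lemma unit_direction_unique (c : R) e v : 0 < c -> enorm e = 1 ->
  c *: e = enorm (c *: e) *: v -> v = e.
Proof.
move=> c0 e1; rewrite enormZ e1 mulr1 gtr0_norm//.
by move/(scalerI (lt0r_neq0 c0)).
Qed.

Lemma enorm_normalize z : z != 0 -> enorm ((enorm z)^-1 *: z) = 1.
Proof.
move=> z0; rewrite enormZ ger0_norm ?invr_ge0 ?enorm_ge0// mulVf// gt_eqF//.
exact: enorm_gt0.
Qed.

(** At such a maximum a cone would touch the subsolution from above with
    infinity Laplacian [- b < - f x]. *)
Lemma cone_no_local_max Omega f w (a b : R) y x (r : R) :
  jet_subsolution Omega f w -> Omega x -> x != y -> 0 <= a -> f x < b ->
  b * enorm (x - y) < a -> 0 < r ->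
  (forall h, enorm h < r ->
    w (x + h) - cone a b y (x + h) <= w x - cone a b y x) -> False.
Proof.
move=> ws Ox xy a0 fb ba r0 wmax.
have [A [[s s0 hs] Ae]] := cone_touched_above b xy a0.
have e1 : enorm ((enorm (x - y))^-1 *: (x - y)) = 1.
  by rewrite enorm_normalize// subr_eq0.
have /(ws _ _ _ Ox)[v [v1 pv fv]] : touched_above w x
    ((a - b * enorm (x - y)) *: ((enorm (x - y))^-1 *: (x - y))) A.
  exists (Num.min r s) => [|h]; first by rewrite lt_min r0.
  by rewrite lt_min => /andP[/wmax + /hs]; lra.
rewrite (unit_direction_unique _ e1 pv) ?subr_gt0// Ae in fv.
by lra.
Qed.

(** Any jet above [c - cone] is above the opposite of the one touching the cone
    from above, so its second order part is at least [b / 2] along [- e]. *)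
Lemma cone_subsolution_at f (c a b : R) y x p A :
  x != y -> 0 <= a -> - f x <= b -> b * enorm (x - y) < a ->
  touched_above (fun x => c - cone a b y x) x p A ->
  exists v, [/\ enorm v = 1, p = enorm p *: v & - f x <= 2 * qf A v].
Proof.
move=> xy a0 fb ba [r r0 hr].
have [B [[s s0 hs] Be]] := cone_touched_above b xy a0.
set m := a - b * enorm (x - y) in hs; have m0 : 0 < m by rewrite subr_gt0.
set e := (enorm (x - y))^-1 *: (x - y) in hs Be.
have e1 : enorm e = 1 by rewrite enorm_normalize// subr_eq0.
clearbody e.
have [pE AB] : - (m *: e) = p /\ forall v, qf (- B) v <= qf A v.
  apply: (@jet_le _ _ _ _ _ _ (Num.min r s)) => [|h]; first by rewrite lt_min r0.
  rewrite lt_min => /andP[/hr + /hs]; rewrite qfNm dotpNl; lra.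
exists (- e); rewrite enormN -pE enormN enormZ e1 mulr1 gtr0_norm// scalerN.
by split=> //; have := AB (- e); rewrite qfNm !qfN Be; lra.
Qed.

End Cones.

(** * Comparison with quadratic cones *)

Section Comparison.
Variables (R : realType) (n : nat) (Omega : set 'rV[R]_n).
Hypothesis Oopen : open Omega.
Hypothesis Obounded : bounded_set Omega.
Implicit Types (x y z h p q v e : 'rV[R]_n) (f w : 'rV[R]_n -> R).

Lemma open_eball x : Omega x ->
  exists2 r : R, 0 < r & forall y, enorm (y - x) < r -> Omega y.
Proof. by move=> Ox; apply/nbhs_enormP; exact: open_nbhs_nbhs. Qed.

Lemma closure_bounded : exists2 D : R, 0 < D &
  forall x, closure Omega x -> enorm x <= D.
Proof.
case: Obounded => M [_ /(_ (`|M| + 1))]; rewrite (le_lt_trans (ler_norm M)) ?ltrDl//.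
move=> /(_ isT) MO; set N := `|M| + 1 in MO; have N0 : 0 < N by rewrite ltr_wpDl.
have clN x : closure Omega x -> enorm x <= n%:R * N.
  move=> cx; apply/ler_addgt0Pr => e e0.
  have [|y [Oy yx]] := cx [set y | enorm (y - x) < e].
    by apply/nbhs_enormP; exists e.
  have := enormD (x - y) y; rewrite subrK enormB.
  have := enorm_le_norm y; have : n%:R * `|y| <= n%:R * N by rewrite ler_wpM2l// MO.
  by move: yx => /=; lra.
exists (n%:R * N + 1) => [|x /clN]; last by lra.
by rewrite ltr_wpDl// mulr_ge0// ltW.
Qed.

Lemma closure_compact : compact (closure Omega).
Proof.
have [D D0 hD] := closure_bounded.
apply: (subclosed_compact _ (compact_enorm_le (x := 0) (r := D))).
  exact: closed_closure.
by move=> x /hD /=; rewrite subr0.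
Qed.

Lemma closure_cases x : closure Omega x -> Omega x \/ boundary Omega x.
Proof.
move=> cx; have [Ox|nOx] := pselect (Omega x); first by left.
by right; split=> // /interior_subset.
Qed.

Lemma boundary_notin x : boundary Omega x -> ~ Omega x.
Proof. by case=> _ + Ox; apply; exact: open_nbhs_nbhs. Qed.

(** The maximum of [w - cone] over the compact closure cannot be attained
    inside [Omega], except at the apex. *)
Lemma cone_comparison f w (c a b : R) y :
  econtinuous_on (closure Omega) w -> jet_subsolution Omega f w ->
  0 <= a ->
  (forall x, Omega x -> f x < b) ->
  (forall x, Omega x -> b * enorm (x - y) < a) ->
  (forall x, boundary Omega x -> w x <= c + cone a b y x) ->
  (Omega y -> w y <= c) ->
  forall x, closure Omega x -> w x <= c + cone a b y x.
Proof.
move=> wc ws a0 fb ba wb wy x cx.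
have [x0 cx0 hx0] : exists2 x0, closure Omega x0 & forall x, closure Omega x ->
    w x - cone a b y x <= w x0 - cone a b y x0.
  apply: (compact_max (w := fun x => w x - cone a b y x)); first by exists x.
    exact: closure_compact.
  by apply: econtinuousB => //; exact: econtinuous_cone.
suff : w x0 - cone a b y x0 <= c by have := hx0 x cx; lra.
have [Ox0|/wb] := closure_cases cx0; last by lra.
have [x0y|x0y] := eqVneq x0 y.
  by rewrite x0y cone_apex subr0 wy// -x0y.
have [r r0 rO] := open_eball Ox0.
exfalso; apply: (cone_no_local_max ws Ox0 x0y a0 (fb _ Ox0) (ba _ Ox0) r0).
move=> h hr; apply: hx0; apply/subset_closure/rO.
by rewrite [x0 + h - x0]addrC addKr.
Qed.

End Comparison.

(** * The Perron function *)

Section Perron.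
Variables (R : realType) (n : nat) (Omega : set 'rV[R]_n).
Variables (f g : 'rV[R]_n -> R) (b M : R).
Hypothesis n_gt0 : (0 < n)%N.
Hypothesis Oopen : open Omega.
Hypothesis Obounded : bounded_set Omega.
Hypothesis fcont : econtinuous_on Omega f.
Hypothesis fb : forall x, Omega x -> `|f x| < b.
Hypothesis b0 : 0 < b.
Hypothesis gcont : econtinuous_on (boundary Omega) g.
Hypothesis gM : forall x, boundary Omega x -> `|g x| <= M.
Hypothesis M0 : 0 <= M.
Implicit Types (x y z h p q v e : 'rV[R]_n) (A B : 'M[R]_n).
Implicit Types (w : 'rV[R]_n -> R).

Let f_lt_b x : Omega x -> f x < b.
Proof. by move=> /fb; rewrite ltr_norml => /andP[]. Qed.

Let fN_le_b x : Omega x -> - f x <= b.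
Proof. by move=> /fb; rewrite ltr_norml => /andP[]; lra. Qed.

Definition perron_class w := [/\ econtinuous_on (closure Omega) w,
  jet_subsolution Omega f w & forall x, boundary Omega x -> w x <= g x].

Definition perron x := sup [set w x | w in perron_class].

(** A cone with apex outside the closure bounds the whole Perron class without
    reference to any boundary point. [D] bounds all distances needed below. *)
Lemma far_point : exists y0, exists2 D : R, 0 <= D & ~ closure Omega y0 /\
  forall x y, closure Omega x -> closure Omega y \/ y = y0 -> enorm (x - y) <= D.
Proof.
have [D D0 hD] := closure_bounded Obounded.
have [v [v1 _]] := unit_direction (0 : 'rV[R]_n) n_gt0.
have yD : enorm ((D + 1) *: v) = D + 1.
  by rewrite enormZ v1 mulr1 ger0_norm//; lra.
exists ((D + 1) *: v); exists (2 * D + 1); first by lra.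
split=> [/hD|x y /hD xD yy]; first by rewrite yD; lra.
have := enormD x (- y); rewrite enormN.
by case: yy => [/hD|->]; rewrite ?yD; lra.
Qed.

Lemma cone_perron_class (c a : R) y : 0 <= a ->
  (forall x, Omega x -> b * enorm (x - y) < a) -> ~ Omega y ->
  (forall x, boundary Omega x -> c - cone a b y x <= g x) ->
  perron_class (fun x => c - cone a b y x).
Proof.
move=> a0 ba nOy cg; split=> //.
  by apply: econtinuousB; [exact: econtinuous_cst|exact: econtinuous_cone].
move=> x p A Ox; apply: cone_subsolution_at => //; last exact: ba.
  by apply/eqP => xy; apply: nOy; rewrite -xy.
exact: fN_le_b.
Qed.

Lemma perron_bounds : exists N : R, [/\ 0 <= N,
  forall w x, perron_class w -> closure Omega x -> w x <= N &
  exists2 w0, perron_class w0 & forall x, closure Omega x -> - N <= w0 x].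
Proof.
have [y0 [D D0 [ny0 yD]]] := far_point.
have [a a0 ha] := cone_large n (@ltr01 R) (lexx 0) (ltW b0) D0.
have {}ha x : closure Omega x ->
    [/\ b * enorm (x - y0) < a, 0 <= cone a b y0 x & cone a b y0 x <= a * D].
  move=> cx; have xD : enorm (x - y0) <= D by apply: yD => //; right.
  have [h1 h2 _] := ha _ _ xD; split=> //.
  by rewrite (le_trans (cone_le a y0 x (ltW b0)))// ler_wpM2l.
have nOy0 : ~ Omega y0 by move=> /subset_closure.
have baO x : Omega x -> b * enorm (x - y0) < a by move=> /subset_closure/ha[].
exists (M + a * D); split; first by rewrite addr_ge0// mulr_ge0.
  move=> w x [wc ws wg] cx.
  have bnd z : boundary Omega z -> w z <= M + cone a b y0 z.
    move=> bz; have [_ + _] := ha z (proj1 bz).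
    by have := wg z bz; have := gM bz; rewrite ler_norml; lra.
  have := cone_comparison Oopen Obounded wc ws a0 f_lt_b baO bnd
    (fun o => False_ind _ (nOy0 o)) cx.
  by have [_ _] := ha _ cx; lra.
exists (fun x => - M - cone a b y0 x) => [|x /ha[_ _]]; last by lra.
apply: cone_perron_class => // x bx; have [_ + _] := ha x (proj1 bx).
by have := gM bx; rewrite ler_norml; lra.
Qed.

Lemma perron_has_sup x : closure Omega x -> has_sup [set w x | w in perron_class].
Proof.
have [N [N0 up [w0 Fw0 _]]] := perron_bounds => cx; split; first by exists (w0 x), w0.
by exists N => _ [w Fw <-]; exact: up.
Qed.

Lemma le_perron w x : perron_class w -> closure Omega x -> w x <= perron x.
Proof.
by move=> Fw cx; apply: (sup_upper_bound (perron_has_sup cx)); exists w.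
Qed.

Lemma perron_le x (c : R) : closure Omega x ->
  (forall w, perron_class w -> w x <= c) -> perron x <= c.
Proof.
move=> /perron_has_sup[ne _] h; apply: ge_sup => // _ [w Fw <-]; exact: h.
Qed.

Lemma perron_bounded : exists2 N : R, 0 <= N &
  forall x, closure Omega x -> - N <= perron x <= N.
Proof.
have [N [N0 up [w0 Fw0 low]]] := perron_bounds; exists N => // x cx.
rewrite (le_trans (low x cx) (le_perron Fw0 cx))/=.
by apply: perron_le => // w Fw; exact: up.
Qed.

(** Steep cones with apex [z] dominate the oscillation of [g]: the upper one
    bounds the class by comparison, the lower one belongs to the class. *)
Lemma perron_boundary_barrier z (e : R) : boundary Omega z -> 0 < e ->
  exists2 a, 0 <= a & forall x, closure Omega x ->
    g z - e - a * enorm (x - z) <= perron x <= g z + e + a * enorm (x - z).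
Proof.
move=> bz e0; have [d d0 gd] := gcont bz e0.
have [y1 [D D0 [_ hD]]] := far_point.
have [a a0 ha] := cone_large n d0 (mulr_ge0 (@ler0n R 2) M0) (ltW b0) D0.
have {}ha x : closure Omega x -> [/\ b * enorm (x - z) < a,
    0 <= cone a b z x & d <= enorm (x - z) -> 2 * M <= cone a b z x].
  by move=> cx; apply: ha; apply: hD => //; left; exact: proj1 bz.
have nOz := boundary_notin Oopen bz.
have baO x : Omega x -> b * enorm (x - z) < a by move=> /subset_closure/ha[].
have gbnd x : boundary Omega x ->
    g z - e - cone a b z x <= g x <= g z + e + cone a b z x.
  move=> bx; have [_ h2 h3] := ha x (proj1 bx).
  have [/h3|/(gd x bx)] := leP d (enorm (x - z)).
    by have := gM bx; have := gM bz; rewrite !ler_norml; lra.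
  by rewrite ltr_norml; lra.
exists a => // x cx; have ca := cone_le a z x (ltW b0); apply/andP; split.
  apply: (@le_trans _ _ (g z - e - cone a b z x)); first by lra.
  apply: (le_perron (w := fun x => g z - e - cone a b z x)) => //.
  by apply: cone_perron_class => // y /gbnd/andP[].
apply: (@le_trans _ _ (g z + e + cone a b z x)); last by lra.
apply: perron_le => // w [wc ws wg].
apply: (cone_comparison Oopen Obounded wc ws a0 f_lt_b baO) => // y dy.
by rewrite (le_trans (wg y dy))//; case/andP: (gbnd y dy).
Qed.

Lemma perron_boundary z : boundary Omega z -> perron z = g z.
Proof.
move=> bz; apply/eqP; rewrite eq_le; apply/andP; split;
  apply/ler_addgt0Pr => e e0;
  have [a _ /(_ z (proj1 bz))] := perron_boundary_barrier bz e0;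
  rewrite subrr enorm0 mulr0 subr0 addr0; lra.
Qed.

(** Comparing a member of the class with the cone of height [perron y] and apex
    [y] gives [w x <= perron y + a |x - y|], with one slope [a] for all members
    and all [y] at a distance from the boundary. *)
Lemma perron_locally_lipschitz x0 : Omega x0 ->
  exists2 r : R, 0 < r & exists2 a, 0 <= a & forall x y,
    enorm (x - x0) < r -> enorm (y - x0) < r ->
    perron x - perron y <= a * enorm (x - y).
Proof.
move=> Ox0; have [r r0 rO] := open_eball Oopen Ox0.
have r20 : 0 < r / 2 by rewrite divr_gt0.
exists (r / 2) => //; have [N N0 hN] := perron_bounded.
have [y1 [D D0 [_ hD]]] := far_point.
have [a a0 ha] := cone_large n r20 (mulr_ge0 (@ler0n R 2) N0) (ltW b0) D0.
exists a => // x y xr yr.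
have Oy : Omega y by apply: rO; lra.
have cx : closure Omega x by apply: subset_closure; apply: rO; lra.
have cy := subset_closure Oy.
have {}ha z : closure Omega z -> [/\ b * enorm (z - y) < a,
    0 <= cone a b y z & r / 2 <= enorm (z - y) -> 2 * N <= cone a b y z].
  by move=> cz; apply: ha; apply: hD => //; left.
rewrite lerBlDl (@le_trans _ _ (perron y + cone a b y x))//; last first.
  by rewrite lerD2l cone_le// ltW.
apply: perron_le => // w Fw; have [wc ws wg] := Fw.
apply: (cone_comparison Oopen Obounded wc ws a0 f_lt_b) => //.
- by move=> z /subset_closure/ha[].
- move=> z bz; have [_ _] := ha z (proj1 bz).
  have zr : r <= enorm (z - x0).
    by rewrite leNgt; apply/negP => /rO; exact: boundary_notin.
  have := enormD (z - y) (y - x0); rewrite addrA subrK => zy /(_ _).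
  have := le_perron Fw (proj1 bz); have := hN z (proj1 bz); have := hN y cy.
  move=> h1 h2 h3 /(_ _) h; have := h ltac:(lra); lra.
- by move=> _; exact: le_perron.
Qed.

Lemma perron_continuous : econtinuous_on (closure Omega) perron.
Proof.
move=> x cx e e0; have [Ox|bx] := closure_cases cx.
  have [r r0 [a a0 lip]] := perron_locally_lipschitz Ox.
  have a10 : 0 < a + 1 by lra.
  exists (Num.min r (e / (a + 1))) => [|y cy]; first by rewrite lt_min r0 divr_gt0.
  rewrite lt_min ltr_pdivlMr// => /andP[yr ye].
  have xr : enorm (x - x) < r by rewrite subrr enorm0.
  have := lip x y xr yr; have := lip y x yr xr; rewrite (enormB x y).
  by have := enorm_ge0 (y - x); rewrite ltr_norml; nra.
have e20 : 0 < e / 2 by rewrite divr_gt0.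
have [a a0 lip] := perron_boundary_barrier bx e20.
have a10 : 0 < 2 * (a + 1) by lra.
exists (e / (2 * (a + 1))) => [|y cy]; first by rewrite divr_gt0.
rewrite ltr_pdivlMr// (perron_boundary bx) => ye.
have := lip y cy; have := enorm_ge0 (y - x); rewrite ltr_norml; nra.
Qed.

(** If a jet at [x0] violates the sub-equation with right-hand side [- F], then
    a slightly more convex paraboloid violates it in a whole neighbourhood. This
    drives both halves of Perron's method: it excludes contact of members of
    the class near [x0], and it makes the opposite paraboloid a subsolution. *)
Lemma jet_nbhd (F : 'rV[R]_n -> R) x0 p A (r : R) :
  econtinuous_on Omega F -> Omega x0 -> 0 < r ->
  (forall v, enorm v = 1 -> p = enorm p *: v -> 2 * qf A v < F x0) ->
  exists B (d s : R), [/\ 0 < d, 0 < s <= r,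
    forall h, qf B h = qf A h + d * enorm h ^+ 2 &
    forall h, enorm h < s -> Omega (x0 + h) /\
      forall v, enorm v = 1 ->
        p + h *m (B + B^T) = enorm (p + h *m (B + B^T)) *: v ->
        2 * qf B v < F (x0 + h)].
Proof.
move=> Fc Ox0 r0 pA.
have [|e e0 he] := @jet_open _ _ p A (F x0 / 2).
  by move=> v v1 pv; have := pA v v1 pv; lra.
have [s1 s10 Fs1] := Fc x0 Ox0 e e0; have [s2 s20 Os2] := open_eball Oopen Ox0.
pose B := A + (e / 2)%:M.
have [C C0 hC] := mulmx_enorm_le (B + B^T).
have C10 : 0 < C + 1 by lra.
have BE h : qf B h = qf A h + e / 2 * enorm h ^+ 2.
  by rewrite qfDm qf_scalar sqr_enorm.
exists B, (e / 2), (Num.min (Num.min r s1) (Num.min s2 (e / (C + 1)))); split=> //.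
- by rewrite divr_gt0.
- by rewrite !lt_min !ge_min r0 s10 s20 divr_gt0// lexx.
move=> h; rewrite !lt_min ltr_pdivlMr// => /andP[/andP[hr hs1] /andP[hs2 hC1]].
have hE : x0 + h - x0 = h by rewrite addrC addKr.
have Oh : Omega (x0 + h) by apply: Os2; rewrite hE.
split=> // v v1 qv.
have := he (p + h *m (B + B^T)) v; rewrite [p + _ - p]addrC addKr.
have near_p : enorm (h *m (B + B^T)) < e.
  by have := hC h; have := enorm_ge0 h; lra.
move=> /(_ near_p v1 qv); rewrite BE v1 expr1n mulr1.
by have := Fs1 _ Oh; rewrite hE => /(_ hs1); rewrite ltr_norml; lra.
Qed.

(** The extra convexity makes the contact with [perron] strict, so a member of
    the class nearly optimal at [x0] has a contact with a translate of the same
    paraboloid at a point close to [x0]. *)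
Lemma perron_subsolution : jet_subsolution Omega f perron.
Proof.
move=> x0 p A Ox0 [r r0 hr]; apply: contrapT => noV.
have pA v : enorm v = 1 -> p = enorm p *: v -> 2 * qf A v < - f x0.
  by move=> v1 pv; rewrite ltNge; apply/negP => fv; apply: noV; exists v.
have [B [d [s [d0 /andP[s0 sr] BE hB]]]] :=
  jet_nbhd (econtinuousN fcont) Ox0 r0 pA.
have cx0 := subset_closure Ox0.
have s20 : 0 < s / 2 by rewrite divr_gt0.
have m0 : 0 < d * (s / 2) ^+ 2 by rewrite mulr_gt0// exprn_gt0.
have [_ [w Fw <-] wx0] := sup_adherent m0 (perron_has_sup cx0).
rewrite -/(perron x0) in wx0; have [wc ws _] := Fw.
pose K := [set y | enorm (y - x0) <= s / 2].
have KO y : K y -> closure Omega y.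
  move=> yK; apply: subset_closure.
  have -> : y = x0 + (y - x0) by rewrite addrC subrK.
  by apply: (proj1 (hB _ _)); move: yK; rewrite /K /=; lra.
pose P y := dotp p (y - x0) + qf B (y - x0).
have Pc : econtinuous_on K P.
  apply: econtinuousD.
    exact/(econtinuous_translate (w := dotp p))/econtinuous_dotp.
  exact/(econtinuous_translate (w := qf B))/econtinuous_qf.
have [||x1 Kx1 x1max] := @compact_max _ _ K (fun y => w y - P y) _
    (compact_enorm_le (x := x0) (r := s / 2)).
- by exists x0; rewrite /K /= subrr enorm0 ltW.
- apply: econtinuousB => // y Ky e e0; have [t t0 ht] := wc y (KO y Ky) e e0.
  by exists t => // z /KO; exact: ht.
set h1 := x1 - x0; have x1E : x1 = x0 + h1 by rewrite addrC subrK.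
have h1s : enorm h1 < s / 2.
  have := x1max x0; rewrite /K /= subrr enorm0 ltW// => /(_ isT).
  have cx1 := KO _ Kx1; have := le_perron Fw cx1.
  have h1r : enorm h1 < r by move: Kx1; rewrite /K /= -/h1; lra.
  have := hr _ h1r; rewrite -x1E /P -/h1 subrr dotp0r qf0 BE.
  move=> u1 u2 u3; have : d * enorm h1 ^+ 2 < d * (s / 2) ^+ 2 by lra.
  by rewrite ltr_pM2l// ltr_sqr ?nnegrE ?enorm_ge0// ltW.
have h1s' : enorm h1 < s by lra.
have [Ox1 noV1] := hB _ h1s'; rewrite -x1E in Ox1 noV1.
have : touched_above w x1 (p + h1 *m (B + B^T)) B.
  exists (s / 2 - enorm h1) => [|k ks]; first by rewrite subr_gt0.
  have := x1max (x1 + k); rewrite /K /P /= [x1 + k - x0]addrAC -/h1.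
  rewrite (le_trans (enormD _ _)); last by lra.
  by move=> /(_ isT); rewrite qfD !dotpDr dotpDl; lra.
by move=> /(ws _ _ _ Ox1)[v [v1 /(noV1 v v1)]]; lra.
Qed.

(** Where the supersolution condition fails, a paraboloid touching [perron] from
    below is a strict subsolution nearby; lifted by [eta] it can be glued to
    [perron] inside a small ball, which gives a larger member of the class. *)
Lemma perron_supersolution :
  jet_subsolution Omega (fun x => - f x) (fun x => - perron x).
Proof.
move=> x0 p A Ox0 [r r0 hr]; apply: contrapT => noV.
have pA v : enorm v = 1 -> p = enorm p *: v -> 2 * qf A v < f x0.
  move=> v1 pv; rewrite ltNge; apply/negP => fv; apply: noV; exists v.
  by rewrite opprK.
have [B [d [s [d0 /andP[s0 sr] BE hB]]]] := jet_nbhd fcont Ox0 r0 pA.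
have s20 : 0 < s / 2 by rewrite divr_gt0.
(* chosen so that the lifted paraboloid is below [perron] when [s / 2 <= |y - x0|] *)
pose eta := d * (s / 2) ^+ 2.
have eta0 : 0 < eta by rewrite mulr_gt0// exprn_gt0.
pose Q y := perron x0 + eta - dotp p (y - x0) - qf B (y - x0).
pose w y := if enorm (y - x0) < s then Num.max (perron y) (Q y) else perron y.
have ballO y : enorm (y - x0) < s -> Omega y.
  by move=> /hB[+ _]; rewrite addrC subrK.
have far y : s / 2 <= enorm (y - x0) -> w y = perron y.
  rewrite /w; case: ifP => // ys sy; apply: max_idPl.
  have yr : enorm (y - x0) < r by lra.
  have := hr _ yr; rewrite [x0 + _]addrC subrK /Q /eta BE.
  have : d * (s / 2) ^+ 2 <= d * enorm (y - x0) ^+ 2.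
    by rewrite ler_pM2l// ler_sqr ?nnegrE ?enorm_ge0// ltW.
  by lra.
have uc := perron_continuous.
have Qc : econtinuous_on (closure Omega) Q.
  apply: econtinuousB; last first.
    exact/(econtinuous_translate (w := qf B))/econtinuous_qf.
  apply: econtinuousB; first exact: econtinuous_cst.
  exact/(econtinuous_translate (w := dotp p))/econtinuous_dotp.
have Fw : perron_class w.
  split.
  - move=> x cx e e0; have [xs|xs] := ltP (enorm (x - x0)) s.
      have [t t0 ht] := econtinuous_max uc Qc cx e0.
      exists (Num.min t (s - enorm (x - x0))) => [|y cy].
        by rewrite lt_min t0 subr_gt0.
      rewrite lt_min => /andP[/(ht y cy) + yx]; rewrite /w xs ifT//.
      by have := enormD (y - x) (x - x0); rewrite addrA subrK; lra.
    have [t t0 ht] := uc x cx e e0.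
    exists (Num.min t (s / 2)) => [|y cy]; first by rewrite lt_min t0.
    rewrite lt_min => /andP[/(ht y cy) + yx]; rewrite !far//; first by lra.
    by have := enormD (x - y) (y - x0); rewrite addrA subrK enormB; lra.
  - move=> x p' A' Ox [t t0 ht].
    have uw y : perron y <= w y.
      by rewrite /w; case: ifP => // _; rewrite le_max lexx.
    have [wx|wx] := eqVneq (w x) (perron x).
      apply: perron_subsolution => //; exists t => // h /ht.
      by rewrite wx; apply: le_trans.
    have [xs wQ] : enorm (x - x0) < s /\ w x = Q x.
      by move: wx; rewrite /w; case: ifP => [xs|]; [case: leP|]; rewrite ?eqxx.
    have [_ noVx] := hB _ xs; rewrite [x0 + _]addrC subrK in noVx.
    set q := p + _ in noVx.
    have [qE BA] : - q = p' /\ forall v, qf (- B) v <= qf A' v.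
      apply: (@jet_le _ _ _ _ _ _ (Num.min t (s - enorm (x - x0)))) => [|h].
        by rewrite lt_min t0 subr_gt0.
      rewrite lt_min => /andP[/ht wh hs].
      have : Q (x + h) <= w (x + h).
        rewrite /w ifT ?le_max ?lexx ?orbT//.
        by have := enormD (x - x0) h; rewrite addrAC; lra.
      move: wh; rewrite wQ /Q [x + h - x0]addrAC /q qfNm.
      by move: (x - x0) => z; rewrite qfD !dotpE; lra.
    have [v [v1 p'v]] := unit_direction p' n_gt0.
    have qv : q = enorm q *: - v by rewrite scalerN -enormN qE -p'v -qE opprK.
    have := noVx (- v); rewrite enormN qfN v1 => /(_ erefl qv).
    by exists v; split=> //; move: (BA v); rewrite qfNm; lra.
  - move=> x bx; rewrite -(perron_boundary bx) far//.
    rewrite leNgt; apply/negP => xs; apply: (boundary_notin Oopen bx).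
    by apply: ballO; lra.
have := le_perron Fw (subset_closure Ox0).
by rewrite /w subrr enorm0 s0 ge_max /Q subrr dotp0r qf0; lra.
Qed.

End Perron.

(** * Existence *)

Lemma boundary_compact (R : realType) (n : nat) (Omega : set 'rV[R]_n) :
  bounded_set Omega -> compact (boundary Omega).
Proof.
move=> Ob; apply: (subclosed_compact _ (closure_compact Ob)); last first.
  by move=> x [].
by apply: closedI; [exact: closed_closure|exact/open_closedC/open_interior].
Qed.

Theorem corollary2p12 (R : realType) (n : nat) (n_gt0 : (0 < n)%N)
    (Omega : set 'rV[R]_n)
    (Omega_open : open Omega)
    (Omega_connected : connected Omega)
    (Omega_bounded : bounded_set Omega)
    (Omega_diam : (path_diam Omega < +oo)%E)
    (f g : 'rV[R]_n -> R)
    (f_cont : {within Omega, continuous f})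
    (f_bounded : [bounded f x | x in Omega])
    (g_cont : {within boundary Omega, continuous g}) :
  exists u : 'rV[R]_n -> R,
    [/\ {within closure Omega, continuous u},
        viscosity_solution Omega f u
      & forall x, boundary Omega x -> u x = g x].
Proof.
have [b b0 fb] : exists2 b : R, 0 < b & forall x, Omega x -> `|f x| < b.
  have [C [_ fC]] := f_bounded; exists (`|C| + 2) => [|x Ox].
    by rewrite ltr_wpDl.
  rewrite (@le_lt_trans _ _ (`|C| + 1)) ?ltrD2l ?ltr1n//.
  by apply: fC => //; rewrite (le_lt_trans (ler_norm C))// ltrDl.
have [M M0 gM] : exists2 M : R, 0 <= M & forall x, boundary Omega x -> `|g x| <= M.
  have [C [_ gC]] := compact_bounded
    (continuous_compact g_cont (boundary_compact Omega_bounded)).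
  exists (`|C| + 1) => [|x bx]; first by rewrite addr_ge0.
  by apply: gC; [rewrite (le_lt_trans (ler_norm C))// ltrDl|exists x].
move/econtinuous_onP : f_cont => fc; move/econtinuous_onP : g_cont => gc.
have uc := perron_continuous n_gt0 Omega_open Omega_bounded fb b0 gc gM M0.
have us := perron_subsolution n_gt0 Omega_open Omega_bounded fc fb b0 gM M0.
have us' := perron_supersolution n_gt0 Omega_open Omega_bounded fc fb b0 gc gM M0.
have ucO : econtinuous_on Omega (perron Omega f g).
  move=> x Ox e e0; have [r r0 hr] := uc x (subset_closure Ox) e e0.
  by exists r => // y /subset_closure; exact: hr.
exists (perron Omega f g); split.
- exact/econtinuous_onP.
- split; split.
  + exact/econtinuous_lsc/econtinuousN.
  + move=> phi x phi2 Ox; exact: (jet_subsolution_plus us).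
  + exact: econtinuous_lsc.
  + move=> phi x phi2 Ox; exact: (jet_subsolution_minus us').
- exact: (perron_boundary n_gt0 Omega_open Omega_bounded fb b0 gc gM M0).
Qed.
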